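(* Let $r$ and $s$ be integers with $r>0$ and $s<-1$. Then the Alexander polynomial of the twisted torus knot $$T(r|s|,\, r|s|-1;\, r,\, s)$$ has leading coefficient $r$ and degree $r|s|\,(r|s|-r-2)+2$.
   Context: Twisted torus knots: for relatively prime integers $p$ and $q$, and integers $0<r\le |p|+|q|$ and $s\in\mathbb{Z}$, the twisted torus knot $T(p,q;r,s)\subset S^3$ is the knot obtained from the standard diagram of the $(p,q)$-torus knot on the flat torus by applying $s$ full twists on $r$ adjacent strands. For $p,q>0$ the torus knot $T(p,q)$ is positive, and a full twist with $s>0$ has the same sign as the crossings of the positive torus knot. Concretely, when $p>q>0$ and $r\le p$ (which is the case here), $T(p,q;r,s)$ is the closure of the $p$-strand braid $(\sigma_1\sigma_2\cdots\sigma_{p-1})^q(\sigma_1\sigma_2\cdots\sigma_{r-1})^{rs}$, where the $\sigma_i$ are the standard generators of the braid group on $p$ strands (for $r=1$ the second factor is trivial). Alexander polynomial conventions: the Alexander polynomial $\Delta_K(t)\in\mathbb{Z}[t,t^{-1}]$ of a knot $K\subset S^3$ is defined only up to multiplication by $\pm t^k$, $k\in\mathbb{Z}$. Its leading coefficient means the absolute value of the coefficient of the highest-degree term, and its degree means the difference between the highest and lowest exponents occurring with nonzero coefficient. *)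

(* Defs.v *)
From HB Require Import structures.
From mathcomp Require Import all_boot all_order all_algebra.

Set Implicit Arguments.
Unset Strict Implicit.
Unset Printing Implicit Defensive.

Import Order.TTheory GRing.Theory Num.Theory.

Local Open Scope ring_scope.

(** A letter [(i, true)] is the standard generator sigma_{i+1} (strand positions
    are numbered from 0), and [(i, false)] is its inverse. *)
Definition braid_word := seq (nat * bool).

Definition braid_inv (w : braid_word) : braid_word :=
  rev [seq (x.1, ~~ x.2) | x <- w].

Definition braid_exp (w : braid_word) (k : int) : braid_word :=
  match k with
  | Posz m => flatten (nseq m w)
  | Negz m => flatten (nseq m.+1 (braid_inv w))
  end.

(** sigma_1 sigma_2 ... sigma_{k-1} *)
Definition braid_stair (k : int) : braid_word :=
  [seq (i, true) | i <- iota 0 `|k|%N.-1].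

(** The twisted torus knot T(p,q;r,s), for p > q > 0 and 0 < r <= p, is the
    closure of this braid on p strands. *)
Definition twisted_torus_braid (p q r s : int) : braid_word :=
  braid_exp (braid_stair p) q ++ braid_exp (braid_stair r) (r * s).

(** A relation [(u, v)] stands for u = v, where u and v are positive words in
    generators numbered by [nat].  Positive words suffice for Wirtinger
    relations, and keep the Fox calculus inside Z[t]. *)
Definition relation := (seq nat * seq nat)%type.

(** Image in Z[t] of the Fox derivative dw/dx_j when every generator is sent
    to t, as by the abelianization of a knot group:
    d(x w)/dx_j = dx/dx_j + x dw/dx_j. *)
Fixpoint fox (j : nat) (w : seq nat) : {poly int} :=
  if w is x :: w' then (x == j)%:R + 'X * fox j w' else 0.

(** The relator u v^-1 has derivative du/dx_j - (u v^-1) dv/dx_j, and u v^-1 is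
    trivial in the group. *)
Definition alexander_matrix (g : nat) (rels : seq relation) :
    'M[{poly int}]_(size rels, g) :=
  \matrix_(i < size rels, j < g)
    (fox j (nth ([::], [::]) rels i).1 - fox j (nth ([::], [::]) rels i).2).

(** Wirtinger presentation of the group of the closure of the braid [w] on [n]
    strands.  Generator [wgen n k j] is the meridian of the strand in position
    [j] between the letters number [k - 1] and [k] of [w], all strands being
    oriented downwards. *)
Definition wgen (n k j : nat) : nat := (k * n + j)%N.

(** Across a letter sigma_{i+1} joining level a (above) to level b (below), the
    over-strand runs from position i to position i+1, so that
    x_{b,i+1} = x_{a,i}  and  x_{b,i} x_{a,i} = x_{a,i} x_{a,i+1}.
    An inverse letter gives the same relations with the levels exchanged. *)
Definition crossing_relation (n k : nat) (l : nat * bool) (j : nat) : relation :=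
  let a := if l.2 then k else k.+1 in
  let b := if l.2 then k.+1 else k in
  let i := l.1 in
  if j == i then
    ([:: wgen n b i; wgen n a i], [:: wgen n a i; wgen n a i.+1])
  else if j == i.+1 then ([:: wgen n b i.+1], [:: wgen n a i])
  else ([:: wgen n b j], [:: wgen n a j]).

Definition closure_relation (n : nat) (w : braid_word) (j : nat) : relation :=
  ([:: wgen n (size w) j], [:: wgen n 0 j]).

Definition closure_ngens (n : nat) (w : braid_word) : nat := ((size w).+1 * n)%N.

Definition closure_relations (n : nat) (w : braid_word) : seq relation :=
  [seq crossing_relation n k (nth (0%N, true) w k) j
     | k <- iota 0 (size w), j <- iota 0 n]
  ++ [seq closure_relation n w j | j <- iota 0 n].

(** Divisibility in Z[t,t^-1] between elements of Z[t]. *)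
Definition laurent_dvd (P Q : {poly int}) : Prop :=
  exists (k : nat) (R : {poly int}), 'X^k * Q = R * P.

(** [D] divides, in Z[t,t^-1], every minor of order g - 1 of [A].  Selections
    [f], [h] that are not increasing only contribute zero or repeated minors
    up to sign. *)
Definition divides_first_minors (m g : nat) (A : 'M[{poly int}]_(m, g))
    (D : {poly int}) : Prop :=
  forall (f : 'I_g.-1 -> 'I_m) (h : 'I_g.-1 -> 'I_g),
    laurent_dvd D (\det (mxsub f h A)).

(** [P] represents the Alexander polynomial of the closure of [w]: it generates
    the smallest principal ideal of Z[t,t^-1] containing the first elementary
    ideal of the Alexander matrix, i.e. it is a gcd of the minors of order
    g - 1.  It is determined up to a unit +-t^k of Z[t,t^-1], and up to such a
    unit it may be taken in Z[t]. *)
Definition is_alexander_polynomial (n : nat) (w : braid_word)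
    (P : {poly int}) : Prop :=
  let A := alexander_matrix (closure_ngens n w) (closure_relations n w) in
  divides_first_minors A P /\
  forall D : {poly int}, divides_first_minors A D -> laurent_dvd D P.

Definition laurent_lead (P : {poly int}) : int := `|lead_coef P|.

(** Exponent of the lowest nonzero term of a nonzero polynomial. *)
Definition low_exponent (P : {poly int}) : nat := find (fun c => c != 0) P.

Definition laurent_degree (P : {poly int}) : int :=
  (size P).-1%:Z - (low_exponent P)%:Z.

(* Main.v *)
Require Import Defs.
From HB Require Import structures.
From mathcomp Require Import all_boot all_order all_algebra.
From mathcomp Require Import fingroup perm fraction.
From mathcomp Require Import zify ring.

Set Implicit Arguments.
Unset Strict Implicit.
Unset Printing Implicit Defensive.

Import Order.TTheory GRing.Theory Num.Theory.

Local Open Scope ring_scope.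

(** Write n = |s|, p = rn, m = p - r - 1 and [k]_x = 1 + x + ... + x^(k-1).

    Cutting the closed braid at every letter groups the Wirtinger generators
    into levels, one vector of p meridians per level.  A letter expresses one
    level as the image of a neighbouring one under a Burau matrix S_i, and the
    closing relations identify the last level with the first.  The rows of the
    Alexander matrix A sum to 0, and A has a left kernel vector whose entries
    are signed powers of t; hence its cofactors agree up to units of
    Z[t,t^-1] ([cofactor_left_kernel], [cofactor_right_kernel]), and any one
    of them is an Alexander polynomial ([divides_first_minorsP]).  What remains
    is to compute one cofactor D.

    Put w = (1,t,...,t^(p-1)), a left fixed vector of every S_i.  Adding w,
    placed in the columns of level 0, to one closing row of A gives a
    determinant equal to [p]_t D; eliminating the levels one at a time by Schur
    complements turns it, up to a signed power of t, into
    det(1 - (1 - e_0 w) B) with B the Burau matrix of the braid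
    ([det_level_mx]).

    The matrix C_k of sigma_{k-1}^-1 ... sigma_1^-1 is t times a cyclic shift
    of the first k coordinates plus a matrix of rank one, so its powers are
    explicit ([stair_mxX]), and so is the full twist C_k^k, which on those k
    coordinates is t^k plus a matrix of rank one.  For the braid at hand
    B = C^-1 G with C = C_p^(p-1) and G = C_r^(rn).  Since w (C - G) = 0,
    det(C - G + u w) is proportional to the number w u ([det_add_rank1]); taking for u
    the constant vector -(1-t) cancels the dense part of C.  What is left,
    [twist_mx], is a lower bidiagonal matrix plus a matrix of rank two, and
    its determinant is a 2 x 2 computation ([det_twist_mx]).  The outcome is
       [r]_t D = r [m+1]_(t^(p-1)) - t [r]_t [m]_(t^p)
    up to a unit.  The right side has constant and leading coefficient r and
    degree (p-1)m, while [r]_t is monic of degree r-1 with constant term 1;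
    since D is a polynomial, comparing the highest and lowest terms shows that
    D has leading coefficient r, up to sign, and degree
    (p-1)m - (r-1) = p(p-r-2) + 2. *)

(** * Determinants of perturbed matrices *)

(** Block elimination: the second factor is the Schur complement of [P]. *)
Lemma det_block_unit (R : comUnitRingType) m n (P : 'M[R]_m) (Q : 'M_(m, n))
    (L : 'M_(n, m)) (W : 'M_n) : P \in unitmx ->
  \det (block_mx P Q L W) = \det P * \det (W - L *m invmx P *m Q).
Proof.
move=> uP; have -> : block_mx P Q L W =
    block_mx P 0 L 1%:M *m block_mx 1%:M (invmx P *m Q) 0 (W - L *m invmx P *m Q).
  rewrite mulmx_block !mulmx0 !mul0mx !mulmx1 !mul1mx !addr0.
  by rewrite mulKVmx // mulmxA addrC subrK.
by rewrite det_mulmx det_lblock det_ublock !det1 mulr1 mul1r.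
Qed.

(** Both sides are the determinant of the block matrix with rows (1, -A) and
    (B, 1), eliminated along either diagonal block. *)
Lemma det_1D_mulmxC (R : comUnitRingType) m n (A : 'M[R]_(m, n)) (B : 'M_(n, m)) :
  \det (1%:M + A *m B) = \det (1%:M + B *m A).
Proof.
have := det_block_unit (- A) B 1%:M (unitmx1 R m).
rewrite det1 mul1r invmx1 mulmx1 mulmxN opprK => <-.
have -> : block_mx 1%:M (- A) B 1%:M =
    block_mx (1%:M + A *m B) (- A) 0 1%:M *m block_mx 1%:M 0 B (1%:M : 'M[R]_n).
  rewrite mulmx_block !mulmx0 !mul0mx !mulmx1 !mul1mx !add0r.
  by rewrite mulNmx addrK.
by rewrite det_mulmx det_lblock det_ublock !det1 !mulr1.
Qed.

(** Left multiplication by [1 + (u' - u) w] carries [A + u w] to [A + u' w], and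
    this factor has determinant [w u']. *)
Lemma det_add_rank1 (F : fieldType) n (A : 'M[F]_n) (w : 'rV_n) (u u' : 'cV_n) :
    w *m A = 0 -> (w *m u) 0 0 = 1 ->
  \det (A + u' *m w) = (w *m u') 0 0 * \det (A + u *m w).
Proof.
move=> wA wu.
have {}wu : w *m u = 1%:M by rewrite [LHS]mx11_scalar wu.
have -> : A + u' *m w = (1%:M + (u' - u) *m w) *m (A + u *m w).
  rewrite mulmxDl mul1mx -mulmxA mulmxDr wA add0r [w *m (u *m w)]mulmxA wu mul1mx.
  by rewrite mulmxBl addrA addrAC addrK.
rewrite det_mulmx det_1D_mulmxC det_mx11 mulmxBr wu; congr (_ * _).
by rewrite addrC subrK.
Qed.

Lemma det_block11 (R : comNzRingType) (a b c d : 'M[R]_1) :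
  \det (block_mx a b c d) = a 0 0 * d 0 0 - b 0 0 * c 0 0.
Proof.
have e1 (x : 'I_1) : lift (lshift 1 (ord0 : 'I_1)) x = rshift 1 ord0.
  by apply/eqP; rewrite [x]ord1 -val_eqE.
have e2 (x : 'I_1) : lift (rshift 1 (ord0 : 'I_1)) x = lshift 1 ord0.
  by apply/eqP; rewrite [x]ord1 -val_eqE.
rewrite (expand_det_row _ (lshift 1 ord0)) big_split_ord /= !big_ord1.
rewrite block_mxEul block_mxEur /cofactor !det_mx11.
rewrite !row'Esub !col'Esub ![mxsub _ _ _ _ _]mxE !(e1, e2) block_mxEdl block_mxEdr /=.
by ring.
Qed.

(** Factor [A] out and exchange the factors of the rank two part, which leaves
    a 2 x 2 determinant. *)
Lemma det_add_rank2 (R : comUnitRingType) n (A : 'M[R]_n) (q1 q2 : 'cV_n) (v1 v2 : 'rV_n) :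
  \det (A + A *m q1 *m v1 + A *m q2 *m v2) =
  \det A * ((1 + (v1 *m q1) 0 0) * (1 + (v2 *m q2) 0 0)
            - (v1 *m q2) 0 0 * (v2 *m q1) 0 0).
Proof.
have -> : A + A *m q1 *m v1 + A *m q2 *m v2 =
          A *m (1%:M + row_mx q1 q2 *m col_mx v1 v2).
  by rewrite mul_row_col !mulmxDr mulmx1 !mulmxA addrA.
rewrite det_mulmx det_1D_mulmxC mul_col_row scalar_mx_block add_block_mx.
by rewrite det_block11 !add0r !mxE.
Qed.

(** Let [N] be [A] with 1 added at the entry [(i', j)].  Its cofactors along
    column [j] are those of [A], and [y N] has a single nonzero entry, so that
    [y N adj N = det N y] says that column [j] of the cofactors is proportional
    to [y]. *)
Lemma cofactor_left_kernel (R : idomainType) n (A : 'M[R]_n) (y : 'rV_n) i i' j :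
  y *m A = 0 -> y 0 i' != 0 -> y 0 i' * cofactor A i j = y 0 i * cofactor A i' j.
Proof.
move=> yA nz; pose N := A + delta_mx i' 0 *m (delta_mx 0 j : 'rV_n).
have cofN k : cofactor N k j = cofactor A k j.
  rewrite /cofactor; congr (_ * \det _); apply/matrixP=> a b.
  by rewrite !mxE big_ord1 !mxE [lift _ _ == j]eq_sym (negPf (neq_lift _ _)) andbF
    mulr0 addr0.
have yN k : \det N * y 0 k = y 0 i' * cofactor A k j.
  have : (y *m N *m \adj N) 0 k = y 0 i' * cofactor A k j.
    rewrite mulmxDr yA add0r mulmxA -colE.
    rewrite !mxE (bigD1 j) //= big1 ?addr0 => [|l lj].
      by rewrite [X in X * _]mxE big_ord1 !mxE !eqxx mulr1 cofN.
    by rewrite [X in X * _]mxE big_ord1 !mxE eqxx (negPf lj) mulr0 mul0r.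
  by rewrite -mulmxA mul_mx_adj mul_mx_scalar mxE.
rewrite -yN mulrC; congr (_ * _).
by apply: (mulfI nz); rewrite mulrC yN.
Qed.

(** The transposed statement for a constant kernel vector. *)
Lemma cofactor_right_kernel (R : idomainType) n (A : 'M[R]_n) i j j' :
  A *m const_mx 1 = 0 :> 'cV_n -> cofactor A i j = cofactor A i j'.
Proof.
move=> A1; have yA : const_mx 1 *m A^T = 0 :> 'rV_n.
  by apply: trmx_inj; rewrite trmx_mul trmxK trmx_const A1 trmx0.
have := cofactor_left_kernel j i yA (i' := j').
by rewrite !mxE oner_eq0 !cofactor_tr !mul1r; apply.
Qed.

(** The perturbed matrix sends the constant vector to a multiple of the [i]-th
    basis vector, and changing row [i] leaves the cofactors of row [i] alone. *)
Lemma det_add_row (R : comUnitRingType) n (A : 'M[R]_n) (v : 'rV_n) i j :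
    A *m const_mx 1 = 0 :> 'cV_n ->
  \det (A + delta_mx i 0 *m v) = (v *m (const_mx 1 : 'cV_n)) 0 0 * cofactor A i j.
Proof.
move=> A1; set N := A + _.
have cofN : cofactor N i j = cofactor A i j.
  rewrite /cofactor; congr (_ * \det _); apply/matrixP=> a b.
  by rewrite !mxE big_ord1 !mxE [lift _ _ == i]eq_sym (negPf (neq_lift _ _)) mul0r addr0.
have : (\adj N *m (N *m const_mx 1 : 'cV_n)) j 0 = \det N.
  by rewrite mulmxA mul_adj_mx mul_scalar_mx !mxE mulr1.
rewrite mulmxDl A1 add0r -mulmxA => <-.
rewrite [v *m _]mx11_scalar mul_mx_scalar -scalemxAr -colE !mxE.
by rewrite cofN.
Qed.

(** An injection that misses [i] is, up to a permutation, the order embedding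
    that skips [i]. *)
Lemma inj_ord_lift n (f : 'I_n -> 'I_n.+1) : injective f ->
  exists (i : 'I_n.+1) (s : 'S_n), forall x, f x = lift i (s x).
Proof.
move=> fi; have [i iNf] : exists i, i \notin codom f.
  apply/existsP; rewrite -[[exists _, _]]negbK; apply/negP=> /existsPn H.
  have : (#|'I_n.+1| <= #|codom f|)%N.
    by apply/subset_leq_card/subsetP=> x _; have := H x; rewrite negbK.
  by rewrite card_codom // !card_ord ltnn.
have fE x : {y : 'I_n | f x = lift i y}.
  have : i != f x by apply: contraNneq iNf => ->; exact: codom_f.
  by move=> /unlift_some [y e _]; exists y.
have gi : injective (fun x => sval (fE x)).
  move=> x y e; apply: fi; apply: etrans (svalP (fE x)) _.
  by apply/esym; apply: etrans (svalP (fE y)) _; congr lift.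
by exists i, (perm gi) => x; rewrite permE; exact: svalP (fE x).
Qed.

(** Repeated rows or columns give zero; otherwise the selections are injective,
    hence permuted order embeddings. *)
Lemma det_mxsub_cofactor (R : comNzRingType) n (A : 'M[R]_n.+1)
    (f h : 'I_n -> 'I_n.+1) :
  \det (mxsub f h A) = 0 \/
  exists i j (b : nat), \det (mxsub f h A) = (-1) ^+ b * cofactor A i j.
Proof.
have [/injectiveP fi|/injectivePn[x [y xy fxy]]] := boolP (injectiveb f); last first.
  by left; apply: (determinant_alternate xy) => k; rewrite !mxE fxy.
have [/injectiveP hi|/injectivePn[x [y xy hxy]]] := boolP (injectiveb h); last first.
  left; rewrite -det_tr.
  by apply: (determinant_alternate xy) => k; rewrite !mxE hxy.
have [i [s fE]] := inj_ord_lift fi; have [j [s' hE]] := inj_ord_lift hi.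
right; exists i, j, (s + (s'^-1)%g + (i + j))%N.
have -> : mxsub f h A = row_perm s (col_perm s' (row' i (col' j A))).
  by apply/matrixP=> a b; rewrite !mxE fE hE.
rewrite row_permE col_permE !det_mulmx !det_perm /cofactor.
rewrite [RHS]mulrA -[in RHS]exprD -addnA addnn -mul2n exprD exprM sqrrN !expr1n.
by rewrite mulr1 exprD -mulrA; congr (_ * _); rewrite mulrC.
Qed.

(** * The Burau matrices of the generators *)

Lemma sum_delta (R : pzSemiRingType) p (f : nat -> R) j :
  (j < p)%N -> \sum_(k < p) (k == j :> nat)%:R * f k = f j.
Proof.
move=> jp; rewrite (bigD1 (Ordinal jp)) //= eqxx mul1r big1 ?addr0 // => k kj.
by rewrite -[_ == j]/(k == Ordinal jp) (negPf kj) mul0r.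
Qed.

(** Entries are indexed by natural numbers so that row and column [i.+1] can be
    named without a proof that they exist.  In this form the Burau matrix is
    visibly the identity plus a matrix of rank one; its rows [i] and [i.+1] are
    (1-t, t) and (1, 0) on the coordinates [i] and [i.+1]. *)
Definition burau_entry (R : comNzRingType) (t : R) (i a b : nat) : R :=
  (a == b)%:R + ((a == i.+1)%:R - t * (a == i)%:R) * ((b == i)%:R - (b == i.+1)%:R).

Definition burau_gen (R : comNzRingType) (t : R) p i : 'M[R]_p :=
  \matrix_(a < p, b < p) burau_entry t i a b.

Definition geom_row (R : comNzRingType) (t : R) p : 'rV[R]_p := \row_(j < p) t ^+ j.

Section BurauGen.
Variables (R : comNzRingType) (t : R) (p i : nat).
Hypothesis ip : (i.+1 < p)%N.

Let u : 'cV[R]_p := \col_a ((a == i.+1 :> nat)%:R - t * (a == i :> nat)%:R).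
Let v : 'rV[R]_p := \row_b ((b == i :> nat)%:R - (b == i.+1 :> nat)%:R).

Lemma burau_gen_refl : burau_gen t p i = 1%:M + u *m v.
Proof. by apply/matrixP=> a b; rewrite !mxE big_ord1 !mxE. Qed.

Let sum_v (f : nat -> R) : \sum_(b < p) v 0 b * f b = f i - f i.+1.
Proof.
under eq_bigr do rewrite mxE mulrBl.
by rewrite sumrB !sum_delta // ltnW.
Qed.

Let sum_u (f : nat -> R) : \sum_(b < p) u b 0 * f b = f i.+1 - t * f i.
Proof.
under eq_bigr do rewrite mxE mulrBl -mulrA.
by rewrite sumrB -mulr_sumr !sum_delta // ltnW.
Qed.

Lemma burau_gen_const : burau_gen t p i *m const_mx 1 = const_mx 1 :> 'cV_p.
Proof.
rewrite burau_gen_refl mulmxDl mul1mx -mulmxA.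
suff -> : v *m (const_mx 1 : 'cV_p) = 0 by rewrite mulmx0 addr0.
apply/matrixP=> a b; rewrite !ord1 mxE.
under eq_bigr do rewrite [const_mx _ _ _]mxE.
by rewrite (sum_v (fun=> 1)) subrr mxE.
Qed.

Lemma geom_row_burau_gen : geom_row t p *m burau_gen t p i = geom_row t p.
Proof.
rewrite burau_gen_refl mulmxDr mulmx1 mulmxA.
suff -> : geom_row t p *m u = 0 by rewrite mul0mx addr0.
apply/matrixP=> a b; rewrite !ord1 mxE.
under eq_bigr do rewrite mulrC [geom_row _ _ _ _]mxE.
by rewrite (sum_u (fun k => t ^+ k)) exprS subrr mxE.
Qed.

Lemma mul_burau_gen (f : nat -> nat -> R) :
  burau_gen t p i *m (\matrix_(a < p, b < p) f a b) =
  \matrix_(a < p, b < p)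
    (f a b + ((a == i.+1 :> nat)%:R - t * (a == i :> nat)%:R) * (f i b - f i.+1 b)).
Proof.
rewrite burau_gen_refl mulmxDl mul1mx -mulmxA; apply/matrixP=> a b.
rewrite !mxE big_ord1 !mxE; congr (_ + _ * _).
under eq_bigr do rewrite [X in _ * X]mxE.
by rewrite (sum_v (fun k => f k b)).
Qed.
End BurauGen.

Lemma det_burau_gen (R : comUnitRingType) (t : R) p i : (i.+1 < p)%N ->
  \det (burau_gen t p i) = - t.
Proof.
move=> ip; rewrite burau_gen_refl det_1D_mulmxC det_mx11 !mxE eqxx.
under eq_bigr do rewrite !mxE mulrBl.
rewrite sumrB !(sum_delta (fun k => (k == i.+1)%:R - t * (k == i)%:R)) ?(ltnW ip) //.
by rewrite !eqxx (ltn_eqF (ltnSn i)) [_.+1 == i]eq_sym (ltn_eqF (ltnSn i)) /=; ring.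
Qed.

(** * The Alexander matrix, level by level *)

Section Levels.
Variables (R : comNzRingType) (t : R) (p : nat).

(** The relations at a letter [l] read [pre_mx l * x + post_mx l * x' = 0], where
    [x] and [x'] are the levels just above and just below [l]. *)
Definition pre_mx (l : nat * bool) : 'M[R]_p :=
  if l.2 then - burau_gen t p l.1 else 1%:M.
Definition post_mx (l : nat * bool) : 'M[R]_p :=
  if l.2 then 1%:M else - burau_gen t p l.1.

Definition pre_entry (l : nat * bool) a b : R :=
  if l.2 then - burau_entry t l.1 a b else (a == b)%:R.
Definition post_entry (l : nat * bool) a b : R :=
  if l.2 then (a == b)%:R else - burau_entry t l.1 a b.

(** Alexander matrix in which the last [p] rows carry only the last level, so
    that the first level is still free.  The recursion peels off the first
    level, which is what the block eliminations below follow. *)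
Fixpoint level_entry (w : braid_word) (i j : nat) : R :=
  match w with
  | [::] => (i == j)%:R
  | l :: w' =>
    if (i < p)%N then
      if (j < p)%N then pre_entry l i j
      else if (j - p < p)%N then post_entry l i (j - p)%N else 0
    else if (j < p)%N then 0 else level_entry w' (i - p)%N (j - p)%N
  end.

Definition level_mx m (w : braid_word) : 'M[R]_m :=
  \matrix_(i < m, j < m) level_entry w i j.

(** [last_level * E * first_level] is the matrix [E] placed in the closing rows
    and the columns of the first level; the closing relations correspond to
    [E = 1]. *)
Definition last_level m k : 'M[R]_(m, p) :=
  \matrix_(i < m, b < p) (i == k * p + b :> nat)%N%:R.
Definition first_level m : 'M[R]_(p, m) :=
  \matrix_(a < p, j < m) (j == a :> nat)%:R.

Lemma pre_mxE l (a b : 'I_p) : pre_mx l a b = pre_entry l a b.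
Proof. by rewrite /pre_mx /pre_entry; case: ifP => _; rewrite !mxE. Qed.

Lemma post_mxE l (a b : 'I_p) : post_mx l a b = post_entry l a b.
Proof. by rewrite /post_mx /post_entry; case: ifP => _; rewrite !mxE. Qed.

Lemma first_levelD m : first_level (p + m) = row_mx 1%:M 0.
Proof.
apply/matrixP=> a j; rewrite !mxE; case: splitP => k ->; rewrite !mxE.
  by rewrite eq_sym.
by rewrite eq_sym (ltn_eqF _) // ltn_addr.
Qed.

Lemma last_levelD m k : last_level (p + m) k.+1 = col_mx 0 (last_level m k).
Proof.
apply/matrixP=> i b; rewrite !mxE; case: splitP => j ->; rewrite !mxE.
  by rewrite ltn_eqF // mulSn -addnA ltn_addr.
by rewrite mulSn -addnA eqn_add2l.
Qed.

Lemma level_mx_cons m l w :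
  level_mx (p + m) (l :: w) =
  block_mx (pre_mx l) (post_mx l *m first_level m) 0 (level_mx m w).
Proof.
apply/matrixP=> i j; rewrite !mxE /=.
case: (splitP i) => i' Ei; rewrite !mxE; case: (splitP j) => j' Ej; rewrite ?mxE.
- by rewrite Ei Ej pre_mxE.
- rewrite Ei Ej addKn.
  under [RHS]eq_bigr do rewrite mulrC post_mxE mxE eq_sym.
  case: ltnP => jp; first by rewrite (sum_delta (post_entry l i')).
  by rewrite big1 // => k _; rewrite ltn_eqF ?mul0r // (leq_trans (ltn_ord k)).
- by [].
- by rewrite Ei Ej !addKn.
Qed.

Definition valid_word (w : braid_word) := all (fun l => l.1.+1 < p)%N w.

Lemma pre_post_const l : (l.1.+1 < p)%N ->
  pre_mx l *m const_mx 1 + post_mx l *m const_mx 1 = 0 :> 'cV_p.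
Proof.
move=> lp; rewrite /pre_mx /post_mx.
by case: ifP => _; rewrite mul1mx mulNmx burau_gen_const // ?subrr ?addNr.
Qed.

Lemma first_level_const m : (p <= m)%N ->
  first_level m *m const_mx 1 = const_mx 1 :> 'cV_p.
Proof.
move=> pm; rewrite -(subnKC pm) first_levelD.
by rewrite -col_mx_const mul_row_col mul1mx mul0mx addr0.
Qed.

Lemma level_mx_const m w : valid_word w -> m = ((size w).+1 * p)%N ->
  level_mx m w *m const_mx 1 = last_level m (size w) *m const_mx 1 :> 'cV_m.
Proof.
elim: w m => [|l w IH] m /=.
  by rewrite mul1n => _ ->; congr (_ *m _); apply/matrixP=> i j; rewrite !mxE.
case/andP => lp wp; rewrite mulSn => ->.
rewrite level_mx_cons last_levelD -col_mx_const mul_block_col mul_col_mx mul0mx.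
rewrite -mulmxA first_level_const ?pre_post_const // ?mulSn ?leq_addr //.
by rewrite mul0mx add0r -IH // mulSn.
Qed.

(** Since [w] is fixed by every Burau matrix, [w] or [-w] on the rows of each
    letter, according to the sign of the letter, makes the levels telescope
    from the first to the last. *)
Lemma level_mx_left_kernel m w : valid_word w -> m = ((size w).+1 * p)%N ->
  exists y : 'rV_m, [/\ y *m level_mx m w = geom_row t p *m first_level m,
    y *m last_level m (size w) = geom_row t p &
    forall i, exists b e, y 0 i = (-1) ^+ b * t ^+ e].
Proof.
elim: w m => [|l w IH] m /=.
  rewrite mul1n => _ ->; exists (geom_row t p); split.
  - by congr (_ *m _); apply/matrixP=> i j; rewrite !mxE eq_sym.
  - by rewrite -[RHS]mulmx1; congr (_ *m _); apply/matrixP=> i j; rewrite !mxE.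
  - by move=> i; exists 0, (nat_of_ord i); rewrite mxE mul1r.
case/andP => lp wp; rewrite mulSn => ->.
have [y [yA yJ yE]] := IH _ wp erefl.
exists (row_mx ((-1) ^+ l.2 *: geom_row t p) y); split.
- rewrite level_mx_cons first_levelD mul_row_block mulmx0 addr0 mul_mx_row mulmx1 mulmx0.
  rewrite yA mulmxA -mulmxDl -[RHS]/(row_mx _ _).
  have -> : (-1) ^+ l.2 *: geom_row t p *m pre_mx l = geom_row t p.
    rewrite /pre_mx; case: ifP => _; rewrite ?mulmx1 ?scale1r //.
    by rewrite scaleN1r mulmxN mulNmx opprK geom_row_burau_gen.
  have -> : (-1) ^+ l.2 *: geom_row t p *m post_mx l = - geom_row t p.
    rewrite /post_mx; case: ifP => _; rewrite ?mulmx1 ?scaleN1r //.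
    by rewrite scale1r mulmxN geom_row_burau_gen.
  by rewrite addNr mul0mx.
- by rewrite last_levelD mul_row_col mulmx0 add0r yJ.
- move=> i; rewrite mxE; case: splitP => j _; last exact: yE.
  by exists (nat_of_bool l.2), (nat_of_ord j); rewrite !mxE.
Qed.

End Levels.

Section LevelDet.
Variables (F : fieldType) (t : F) (p : nat).
Hypothesis t0 : t != 0.

Lemma burau_gen_unit i : (i.+1 < p)%N -> burau_gen t p i \in unitmx.
Proof. by move=> ip; rewrite unitmxE det_burau_gen // unitfE oppr_eq0. Qed.

(** The matrix that expresses the first level in terms of the last one, whence
    the inverse at positive letters. *)
Fixpoint burau_word (w : braid_word) : 'M[F]_p :=
  if w is l :: w' then
    (if l.2 then invmx (burau_gen t p l.1) else burau_gen t p l.1) *m burau_word w'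
  else 1%:M.

(** Eliminating the first level multiplies the perturbation [E] on the right by
    the Burau matrix of the first letter, and contributes a signed power of
    [t]. *)
Lemma det_level_mx m w (E : 'M[F]_p) : valid_word p w -> m = ((size w).+1 * p)%N ->
  exists b e, \det (level_mx t p m w - last_level F p m (size w) *m E *m first_level F p m)
     = (-1) ^+ b * t ^+ e * \det (1%:M - E *m burau_word w).
Proof.
elim: w m E => [|l w IH] m E /=.
  rewrite mul1n => _ ->; exists 0, 0; rewrite !expr0 !mul1r mulmx1.
  congr (\det (_ - _)); first by apply/matrixP=> i j; rewrite !mxE.
  rewrite -[RHS]mul1mx -[RHS]mulmx1; congr (_ *m _ *m _); apply/matrixP=> i j; rewrite !mxE //.
  by rewrite eq_sym.
case/andP => lp wp; rewrite mulSn => ->.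
set m' := ((size w).+1 * p)%N.
have uP : pre_mx t p l \in unitmx.
  rewrite /pre_mx; case: ifP => _; last exact: unitmx1.
  by rewrite -scaleN1r unitmxZ ?unitrN1 // burau_gen_unit.
have detP : exists b e, \det (pre_mx t p l) = (-1) ^+ b * t ^+ e.
  rewrite /pre_mx; case: ifP => _; last by exists 0, 0; rewrite det1 mulr1.
  exists p.+1, 1; rewrite -scaleN1r detZ det_burau_gen // exprS; ring.
rewrite level_mx_cons last_levelD first_levelD.
rewrite mul_col_mx mul0mx mul_col_row !mul0mx mulmx0 mulmx1.
rewrite opp_block_mx !oppr0 add_block_mx !addr0 add0r det_block_unit //.
set X := _ - _ *m _ *m _.
have {X}-> : X = level_mx t p m' w - last_level F p m' (size w)
    *m - (E *m invmx (pre_mx t p l) *m post_mx t p l) *m first_level F p m'.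
  by rewrite /X !mulNmx !mulmxN !mulNmx !mulmxA.
have [b [e ->]] := IH m' (- (E *m invmx (pre_mx t p l) *m post_mx t p l)) wp erefl.
have [b' [e' ->]] := detP; exists (b' + b)%N, (e' + e)%N.
rewrite !exprD !mulrA [_ * t ^+ e' * _]mulrAC; congr (_ * \det (_ - _)).
rewrite !mulmxA; congr (_ *m _); rewrite /pre_mx /post_mx; case: ifP => lE.
  rewrite /pre_mx lE -scaleN1r in uP.
  rewrite -[- burau_gen _ _ _]scaleN1r invmxZ // invrN1 scaleN1r.
  by rewrite mulmxN mulmx1 opprK.
by rewrite invmx1 mulmx1 mulmxN opprK.
Qed.
End LevelDet.

Definition fox_row (j : nat) (rel : relation) : {poly int} := fox j rel.1 - fox j rel.2.

Definition shift_relation (n : nat) (rel : relation) : relation :=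
  (map (addn n) rel.1, map (addn n) rel.2).

(** Prepending a letter to a word renumbers the generators of all later levels
    by [n]. *)
Lemma fox_row_shift n j rel :
  fox_row j (shift_relation n rel) = if (j < n)%N then 0 else fox_row (j - n) rel.
Proof.
have foxE u : fox j (map (addn n) u) = if (j < n)%N then 0 else fox (j - n) u.
  elim: u => [|x u IH] /=; first by case: ifP.
  rewrite IH; case: ltnP => jn; first by rewrite mulr0 addr0 gtn_eqF // ltn_addr.
  by rewrite -(eqn_add2l n x) subnKC.
by rewrite /fox_row /= !foxE; case: ifP => _; rewrite ?subr0.
Qed.

Lemma shift_crossing n k l j :
  crossing_relation n k.+1 l j = shift_relation n (crossing_relation n k l j).
Proof.
rewrite /crossing_relation /shift_relation /wgen.
by do ![case: ifP => _ /=]; rewrite !mulSn -?addnA.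
Qed.

Definition letter_relations n (w : braid_word) : seq relation :=
  [seq crossing_relation n k (nth (0%N, true) w k) j
     | k <- iota 0 (size w), j <- iota 0 n].

Lemma letter_relations_cons n l w : letter_relations n (l :: w) =
  [seq crossing_relation n 0 l j | j <- iota 0 n] ++
  [seq shift_relation n rel | rel <- letter_relations n w].
Proof.
rewrite /letter_relations /= -[1%N]addn0 iotaDl -map_comp map_flatten -map_comp.
congr (_ ++ flatten _); apply: eq_map => k /=.
by rewrite -map_comp; apply: eq_map => j /=; rewrite shift_crossing.
Qed.

Lemma size_letter_relations n w : size (letter_relations n w) = (size w * n)%N.
Proof. by rewrite size_allpairs !size_iota. Qed.

Lemma fox_row_crossing n l i j : (l.1.+1 < n)%N -> (i < n)%N ->
  fox_row j (crossing_relation n 0 l i) =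
  if (j < n)%N then pre_entry 'X l i j
  else if (j - n < n)%N then post_entry 'X l i (j - n)%N else 0.
Proof.
case: l => k e /= kn i_n; have kn' := ltnW kn.
have kk : (k == k.+1) = false by rewrite ltn_eqF.
rewrite /crossing_relation /fox_row /pre_entry /post_entry /burau_entry.
have w0 x : wgen n 0 x = x by [].
have w1 x : wgen n 1 x = (n + x)%N by rewrite /wgen mul1n.
case: (ltnP j n) => jn.
  have hi x : (n + x == j) = false by rewrite gtn_eqF // ltn_addr.
  case: e; case: (i =P k) => [->|/eqP ik] /=; rewrite ?w0 ?w1 ?hi ?kk ?eqxx /=.
  - by rewrite ![j == _]eq_sym; ring.
  - case: (i =P k.+1) => [->|/eqP ik'] /=; rewrite ?w0 ?w1 ?hi /=.
      by rewrite ![j == _]eq_sym; ring.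
    by ring.
  - by ring.
  - by case: (i =P k.+1) => [->|/eqP ik'] /=; rewrite ?w0 ?w1 ?hi /=; ring.
have lo x : (x < n)%N -> (x == j) = false by move=> xn; rewrite ltn_eqF // (leq_trans xn).
have hi x : (n + x == j) = (x == (j - n)%N) by rewrite -{1}(subnKC jn) eqn_add2l.
have out x : (x < n)%N -> (j - n < n)%N = false -> (x == (j - n)%N) = false.
  by move=> xn /negbT; rewrite -leqNgt => /(leq_trans xn) /ltn_eqF.
have oi := out i i_n; have ok := out k kn'; have ok1 := out k.+1 kn.
case: e; case: (i =P k) => [ik|/eqP ik] /=; rewrite ?ik ?w0 ?w1 ?hi ?kk ?eqxx
  ?(lo i) ?(lo k) ?(lo k.+1) //=.
- by case: ifP => [_|/ok ->] /=; ring.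
- case: (i =P k.+1) => [ik'|/eqP ik'] /=; rewrite ?ik' ?w0 ?w1 ?hi
    ?(lo i) ?(lo k) ?(lo k.+1) //=.
    by case: ifP => [_|/ok1 ->] /=; ring.
  by case: ifP => [_|/oi ->] /=; ring.
- case: ifP => [_|jn']; last by rewrite (ok jn') (ok1 jn') /=; ring.
  by rewrite ![(j - n)%N == _]eq_sym; ring.
- case: (i =P k.+1) => [ik'|/eqP ik'] /=; rewrite ?ik' ?w0 ?w1 ?hi
    ?(lo i) ?(lo k) ?(lo k.+1) //=.
    case: ifP => [_|jn']; last by rewrite (ok jn') /=; ring.
    by rewrite ![(j - n)%N == _]eq_sym; ring.
  by case: ifP => [_|/oi ->] /=; ring.
Qed.

Lemma fox_row_letter n w i j : valid_word n w -> (i < size w * n)%N ->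
  fox_row j (nth ([::], [::]) (letter_relations n w) i) = level_entry 'X n w i j.
Proof.
elim: w i j => [|l w IH] i j /=; first by rewrite mul0n.
case/andP => ln wn iL.
rewrite letter_relations_cons nth_cat size_map size_iota; case: ltnP => i_n.
  by rewrite (nth_map 0%N) ?size_iota // nth_iota // fox_row_crossing.
have iL' : (i - n < size w * n)%N by move: iL; rewrite mulSn; lia.
rewrite (nth_map ([::], [::])) ?size_letter_relations // fox_row_shift.
by case: ifP => // _; rewrite IH.
Qed.

Lemma level_entry_last n w i j : 
  level_entry ('X : {poly int}) n w (size w * n + i) j = (size w * n + i == j)%N%:R.
Proof.
elim: w j => [|l w IH] j //=.
rewrite mulSn -addnA ltnNge leq_addr /= addKn IH; case: ltnP => jn.
  by rewrite gtn_eqF // ltn_addr.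
by rewrite -{2}(subnKC jn) eqn_add2l.
Qed.

Lemma size_closure_relations n w :
  size (closure_relations n w) = ((size w).+1 * n)%N.
Proof.
by rewrite size_cat size_letter_relations size_map size_iota mulSnr.
Qed.

Lemma alexander_entry n w i j : valid_word n w -> (i < (size w).+1 * n)%N ->
  fox_row j (nth ([::], [::]) (closure_relations n w) i) =
  level_entry 'X n w i j - ((i == size w * n + j) && (j < n))%N%:R.
Proof.
move=> wn iL; rewrite nth_cat -/(letter_relations n w) size_letter_relations.
case: ltnP => iw; first by rewrite fox_row_letter // ltn_eqF ?subr0 // ltn_addr.
have i_n : (i - size w * n < n)%N by move: iL; rewrite mulSnr; lia.
rewrite (nth_map 0%N) ?size_iota // nth_iota // /fox_row /= /wgen mul0n !add0n.
rewrite -{3 4}(subnKC iw) level_entry_last mulr0 !addr0 eqn_add2l.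
congr (_ - _%:R); case: eqP => [<-|] //=.
by rewrite i_n.
Qed.

Lemma alexander_level_mx n w :
  valid_word n w ->
  forall (i : 'I_(size (closure_relations n w))) (j : 'I_(closure_ngens n w))
         (i' : 'I_(closure_ngens n w)), i = i' :> nat ->
  alexander_matrix (closure_ngens n w) (closure_relations n w) i j =
  (level_mx 'X n (closure_ngens n w) w -
   last_level _ n (closure_ngens n w) (size w) *m first_level _ n (closure_ngens n w)) i' j.
Proof.
move=> wn i j i' ii'; rewrite mxE -/(fox_row j _) alexander_entry //; last first.
  by rewrite -size_closure_relations.
rewrite !mxE -ii'; congr (_ - _).
under eq_bigr do rewrite !mxE mulrC [nat_of_ord j == _]eq_sym.
case: (ltnP j n) => jn.
  by rewrite ii' (sum_delta (fun b => (i' == size w * n + b :> nat)%N%:R)) // andbT.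
by rewrite andbF big1 // => b _; rewrite ltn_eqF ?mul0r // (leq_trans (ltn_ord b)).
Qed.

(** * Geometric sums *)

(** The q-analogue of [n], with q = [x]. *)
Definition gsum (R : pzSemiRingType) (x : R) n : R := \sum_(k < n) x ^+ k.

Lemma gsumS (R : pzSemiRingType) (x : R) n : gsum x n.+1 = gsum x n + x ^+ n.
Proof. by rewrite /gsum big_ord_recr. Qed.

Lemma gsumSl (R : pzSemiRingType) (x : R) n : gsum x n.+1 = 1 + x * gsum x n.
Proof.
rewrite /gsum big_ord_recl expr0 mulr_sumr; congr (_ + _).
by apply: eq_bigr => k _; rewrite -exprS.
Qed.

Lemma gsumE (R : comPzRingType) (x : R) n : (1 - x) * gsum x n = 1 - x ^+ n.
Proof. by rewrite -[1 - x ^+ n]opprB subrX1 -mulNr opprB. Qed.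

Lemma sum_prefix (R : pzSemiRingType) r p (f : nat -> R) : (r <= p)%N ->
  \sum_(b < p) (b < r)%N%:R * f b = \sum_(b < r) f b.
Proof.
move=> rp; rewrite (big_ord_widen p f rp) [RHS]big_mkcond /=.
by apply: eq_bigr => b _; case: ifP => _; rewrite ?mul1r ?mul0r.
Qed.

(** * Burau matrices of stairs and full twists *)

Section Stair.
Variables (F : fieldType) (t : F) (p : nat).

(** [S_{k-2} ... S_0], the Burau matrix of the inverse of [braid_stair k]. *)
Definition stair_mx k : 'M[F]_p := \matrix_(i < p, b < p)
  if (i < k)%N then
    if i.+1 == k then (b == 0%N :> nat)%:R
    else (1 - t) * (b == 0%N :> nat)%:R + t * (b == i.+1 :> nat)%:R
  else (b == i :> nat)%:R.

Lemma stair_mx1 : stair_mx 1 = 1%:M.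
Proof.
apply/matrixP=> i b; rewrite !mxE -(inj_eq val_inj) /= [(i : nat) == b]eq_sym.
by case: ltnP => //; rewrite ltnS leqn0 => /eqP ->.
Qed.

Lemma mul_stair_mx k (f : nat -> nat -> F) : (0 < k <= p)%N ->
  stair_mx k *m (\matrix_(i < p, b < p) f i b) =
  \matrix_(i < p, b < p)
    if (i < k)%N then if i.+1 == k then f 0%N b else (1 - t) * f 0%N b + t * f i.+1 b
    else f i b.
Proof.
case/andP=> k0 kp; apply/matrixP=> i b; rewrite !mxE.
under eq_bigr do rewrite !mxE.
have p0 : (0 < p)%N by apply: leq_trans kp.
case: ltnP => ik; last by rewrite (sum_delta (fun j => f j b)).
case: eqP => ik'; first by rewrite (sum_delta (fun j => f j b)).
under eq_bigr do rewrite mulrDl -!mulrA.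
rewrite big_split -!mulr_sumr !(sum_delta (fun j => f j b)) //.
by apply: leq_trans kp; rewrite ltn_neqAle ik andbT; apply/eqP.
Qed.

Lemma stair_mxS k : (0 < k < p)%N -> stair_mx k.+1 = burau_gen t p k.-1 *m stair_mx k.
Proof.
case: k => // k /= kp; rewrite /stair_mx (mul_burau_gen _ kp (fun i b : nat =>
  if (i < k.+1)%N then
    if i.+1 == k.+1 then (b == 0%N)%:R
    else (1 - t) * (b == 0%N)%:R + t * (b == i.+1)%N%:R
  else (b == i)%N%:R)).
apply/matrixP=> i b; rewrite !mxE ltnSn eqxx ltnn !eqSS ltnS.
case: (ltngtP i k.+1) => ik; rewrite ?ik /= ?(gtn_eqF ik) ?(ltn_eqF ik).
- case: (ltngtP i k) => ik' /=; first by ring.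
    by move: ik ik'; lia.
  by rewrite -ik'; ring.
- have -> : (i == k :> nat) = false by move: ik; lia.
  by rewrite /=; ring.
- have -> : (k.+1 == k) = false by lia.
  by rewrite /=; ring.
Qed.

Lemma det_stair_mx k : (0 < k <= p)%N -> \det (stair_mx k) = (- t) ^+ k.-1.
Proof.
elim: k => // -[|k] IH /= kp; first by rewrite stair_mx1 det1.
by rewrite stair_mxS // det_mulmx det_burau_gen // IH ?exprS //= ltnW.
Qed.

(** On the first [k] coordinates, [t ^ j] times a cyclic shift plus rank one. *)
Definition stair_pow_entry k j (i b : nat) : F :=
  if (i < k)%N then t ^+ j * (b == (i + j) %% k)%N%:R + (1 - t) * ((b < j)%N%:R * t ^+ b)
  else (b == i)%:R.

(** The shift fixes the constant vector, so each further factor adds one term to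
    the row of the rank one part.  At [j = k] the shift is trivial and the
    matrix is that of a full twist. *)
Lemma stair_mxX k j : (0 < k <= p)%N -> (j <= k)%N ->
  stair_mx k ^+ j = \matrix_(i < p, b < p) stair_pow_entry k j i b.
Proof.
move=> kp; elim: j => [|j IH] jk.
  rewrite expr0; apply/matrixP=> i b; rewrite !mxE /stair_pow_entry eq_sym -(inj_eq val_inj) /=.
  by case: ltnP => ik //; rewrite addn0 modn_small //; ring.
rewrite exprS IH 1?ltnW // -[LHS]/(_ *m _) (mul_stair_mx _ kp).
apply/matrixP=> i b; rewrite !mxE /stair_pow_entry.
have [k0 _] := andP kp.
case: (ltnP i k) => // ik; rewrite k0 add0n modn_small //.
have bj : (b < j.+1)%N%:R * t ^+ b = (b < j)%N%:R * t ^+ b + (b == j :> nat)%:R * t ^+ j.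
  case: (ltngtP b j) => bj; rewrite ltnS leq_eqVlt.
  - by rewrite bj orbT /=; ring.
  - by rewrite ltnNge (ltnW bj) (gtn_eqF bj) /=; ring.
  - by rewrite bj eqxx /=; ring.
rewrite bj; case: eqP => [ik'|/eqP ik'].
  have -> : (i + j.+1 = j + k)%N by lia.
  by rewrite modnDr modn_small // exprS; ring.
have -> : (i.+1 < k)%N by rewrite ltn_neqAle ik' ik.
by rewrite addSnnS exprS; ring.
Qed.

Definition twist_entry r n (i b : nat) : F :=
  if (i < r)%N then t ^+ (r * n) * (b == i)%:R
    + (1 - t) * gsum (t ^+ r) n * ((b < r)%N%:R * t ^+ b)
  else (b == i)%:R.

(** A full twist is [t ^ r] plus a rank one matrix having the constant vector as
    eigenvector of eigenvalue 1, so its powers keep this form. *)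
Lemma full_twistX r n : (0 < r <= p)%N ->
  stair_mx r ^+ (r * n) = \matrix_(i < p, b < p) twist_entry r n i b.
Proof.
move=> rp; rewrite exprM (stair_mxX rp) //; have [r0 r_p] := andP rp.
elim: n => [|n IH].
  rewrite expr0; apply/matrixP=> i b; rewrite !mxE /twist_entry eq_sym -(inj_eq val_inj) /=.
  by case: ltnP => // _; rewrite muln0 /gsum big_ord0; ring.
rewrite exprS IH -[LHS]/(_ *m _); apply/matrixP=> i b; rewrite !mxE.
under eq_bigr do rewrite !mxE.
under eq_bigr do rewrite /stair_pow_entry.
case: (ltnP i r) => ir; last first.
  rewrite (sum_delta (fun j => twist_entry r n j b)) //.
  by rewrite /twist_entry ltnNge ir.
under eq_bigr do rewrite mulrDl -!mulrA modnDr modn_small //.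
rewrite big_split -!mulr_sumr (sum_delta (fun j => twist_entry r n j b)) //=.
rewrite (sum_prefix (fun j => t ^+ j * twist_entry r n j b)) //.
have -> : \sum_(j < r) t ^+ j * twist_entry r n j b =
    t ^+ (r * n) * ((b < r)%N%:R * t ^+ b)
    + gsum t r * ((1 - t) * gsum (t ^+ r) n * ((b < r)%N%:R * t ^+ b)).
  under eq_bigr do rewrite /twist_entry ltn_ord mulrDr mulrCA [t ^+ _ * _%:R]mulrC eq_sym.
  rewrite big_split -mulr_sumr -mulr_suml; congr (_ * _ + _).
  case: ltnP => br; first by rewrite (sum_delta (fun j => t ^+ j)) // mul1r.
  by rewrite mul0r big1 // => j _; rewrite ltn_eqF ?mul0r // (leq_trans (ltn_ord j)).
rewrite /twist_entry ir mulnS exprD gsumS [t ^+ (r * n)]exprM.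
set g := gsum _ n; set c := _ * t ^+ b; set x := (t ^+ r) ^+ n.
have tr : t ^+ r = 1 - (1 - t) * gsum t r by rewrite gsumE subKr.
have gx : x = 1 - (1 - t ^+ r) * g by rewrite /g gsumE subKr.
by rewrite gx tr; ring.
Qed.

End Stair.

Lemma braid_inv_cons l w : braid_inv (l :: w) = rcons (braid_inv w) (l.1, ~~ l.2).
Proof. by rewrite /braid_inv /= rev_cons. Qed.

Lemma braid_inv_rcons l w : braid_inv (rcons w l) = (l.1, ~~ l.2) :: braid_inv w.
Proof. by rewrite /braid_inv map_rcons rev_rcons. Qed.

Lemma valid_word_inv p w : valid_word p (braid_inv w) = valid_word p w.
Proof. by rewrite /valid_word /braid_inv all_rev all_map. Qed.

Lemma valid_word_rep p w k : valid_word p w -> valid_word p (flatten (nseq k w)).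
Proof. by move=> wp; elim: k => //= k IH; rewrite /valid_word all_cat; apply/andP. Qed.

Lemma valid_stair p k : (k <= p)%N -> valid_word p (braid_stair k).
Proof.
by move=> kp; apply/allP=> x /mapP[i]; rewrite mem_iota => ik ->; move: ik => /=; lia.
Qed.

Section Words.
Variables (F : fieldType) (t : F) (p : nat).
Hypothesis t0 : t != 0.

Lemma burau_word_cat w1 w2 :
  burau_word t p (w1 ++ w2) = burau_word t p w1 *m burau_word t p w2.
Proof. by elim: w1 => [|l w IH] /=; rewrite ?mul1mx // IH mulmxA. Qed.

Lemma burau_word_rep w k :
  burau_word t p (flatten (nseq k w)) = burau_word t p w ^+ k.
Proof.
elim: k => [|k IH]; first by rewrite expr0.
by rewrite exprS /= burau_word_cat IH.
Qed.

Lemma burau_word_inv w : valid_word p w ->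
  burau_word t p w *m burau_word t p (braid_inv w) = 1%:M.
Proof.
elim: w => [|l w IH] /=; first by rewrite mulmx1.
case/andP => lp wp; rewrite braid_inv_cons -cats1 burau_word_cat -mulmxA.
rewrite [burau_word t p w *m _]mulmxA IH // mul1mx /= mulmx1.
by case: l.2; rewrite /= ?mulmxV ?mulVmx // burau_gen_unit.
Qed.

Lemma geom_row_burau_word w : valid_word p w ->
  geom_row t p *m burau_word t p w = geom_row t p.
Proof.
elim: w => [|l w IH] /=; first by rewrite mulmx1.
case/andP => lp wp; rewrite mulmxA.
have -> : geom_row t p *m (if l.2 then invmx (burau_gen t p l.1) else burau_gen t p l.1)
  = geom_row t p; last exact: IH.
case: l.2; last exact: geom_row_burau_gen.
by rewrite -{1}(geom_row_burau_gen t lp) mulmxK // burau_gen_unit.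
Qed.

Lemma burau_word_stair_inv k : (0 < k <= p)%N ->
  burau_word t p (braid_inv (braid_stair k)) = stair_mx t p k.
Proof.
elim: k => // -[|k] IH /= kp; first by rewrite stair_mx1.
rewrite stair_mxS // -(IH (ltnW kp)).
have -> : braid_stair k.+2 = rcons (braid_stair k.+1) (k, true).
  by rewrite /braid_stair -[`|_|%N.-1]/(k.+1) -[in LHS]addn1 iotaD add0n map_cat cats1.
by rewrite braid_inv_rcons.
Qed.

End Words.

(** * A bidiagonal matrix perturbed by rank two *)

Section TwistDet.
Variables (F : fieldType) (t : F).
Hypothesis t0 : t != 0.
Hypothesis tk : forall k, t ^+ k.+1 != 1.

Let t1 k : 1 - t ^+ k.+1 != 0.
Proof. by rewrite subr_eq0 eq_sym. Qed.

Variables (r n m : nat).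
Let p := (m + r).+1.
Hypothesis r0 : (0 < r)%N.
Hypothesis prn : p = (r * n)%N.

(** The product of [gsum x r] with the Alexander polynomial, up to a unit,
    where [p = (m + r).+1]. *)
Definition twist_numer (R : comNzRingType) (x : R) (p m r : nat) : R :=
  r%:R * gsum (x ^+ p.-1) m.+1 - x * gsum x r * gsum (x ^+ p) m.

Let a := t ^+ (m + r).
Let c := (1 - t) * gsum (t ^+ r) n.
Let d (i : nat) := if (i < r)%N then t ^+ p else 1.

Let b0 : 'M[F]_p := \matrix_(i < p, b < p)
  (a * (i == b.+1 :> nat)%:R - d i * (b == i :> nat)%:R).
(* [q1] and [q2] solve [b0 q = u], [b0] being the bidiagonal part, for the two
   columns [u] of the rank two part: a linear recursion of order one, with ratio
   [1/t] in the first [r] rows and [a] in the others. *)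
Let q1 (i : nat) : F := if (i < r)%N then -1 else -1 + (1 - t ^+ p) * gsum a (i - r).+1.
Let q2 (i : nat) : F := if (i < r)%N then c / a * gsum t i.+1 / t ^+ i.+1
                  else a ^+ (i - r).+1 * (c / a) * gsum t r / t ^+ r.

(** [C - G - (1 - t) 1 w] in the notation of the overview above. *)
Definition twist_mx : 'M[F]_p := \matrix_(i < p, b < p)
  (a * (b == (i + (m + r)) %% p :> nat)%N%:R - (1 - t) * a * (b == m + r :> nat)%N%:R
   - twist_entry t r n i b).

Let a0 : a != 0. Proof. exact: expf_neq0. Qed.
Let at_ : a * t = t ^+ p. Proof. by rewrite /a /p exprSr. Qed.

Let mul_b0 (f : nat -> F) (i : nat) : (i < p)%N ->
  \sum_(j < p) (a * (i == j.+1 :> nat)%:R - d i * (j == i :> nat)%:R) * f j =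
  a * (if i is i'.+1 then f i' else 0) - d i * f i.
Proof.
move=> ip; under eq_bigr do rewrite mulrBl -!mulrA.
rewrite sumrB -!mulr_sumr (sum_delta f) //; congr (_ * _ - _).
case: i ip => [|i] ip; first by rewrite big1 // => j _; rewrite mul0r.
under eq_bigr do rewrite eqSS eq_sym.
by rewrite (sum_delta f) // ltnW.
Qed.

Let q1E i : (i < p)%N ->
  a * (if i is i'.+1 then q1 i' else 0) - d i * q1 i = a * ((i == 0%N)%:R - (1 - t)).
Proof.
move=> ip; rewrite /q1 /d; case: i ip => [|i] ip.
  by rewrite r0 -at_ /=; ring.
rewrite -[_.+1 == 0%N]/false; case: (ltngtP i.+1 r) => ir.
- by rewrite -at_ /=; ring.
- by rewrite (subSn (ir : (r <= i)%N)) (gsumSl a (_.+1)) -at_ /=; ring.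
- by rewrite ir subnn gsumSl /gsum big_ord0 -at_ /=; ring.
Qed.

Let q2E i : (i < p)%N ->
  a * (if i is i'.+1 then q2 i' else 0) - d i * q2 i = - c * (i < r)%N%:R.
Proof.
move=> ip; rewrite /q2 /d; case: i ip => [|i] ip.
  by rewrite r0 -at_ /gsum big_ord1 expr0 expr1 mulr1 /=; field; rewrite a0 t0.
case: (ltngtP i.+1 r) => ir.
- rewrite -at_ (gsumS t i.+1) (exprS t i.+1) /=; field.
  by rewrite a0 t0 expf_neq0.
- by rewrite (subSn (ir : (r <= i)%N)) (exprS a (_.+1)) /=; ring.
- by rewrite ir subnn /=; ring.
Qed.

Let v1 : 'rV[F]_p := \row_b (b == m + r :> nat)%N%:R.
Let v2 : 'rV[F]_p := \row_b ((b < r)%N%:R * t ^+ b).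
Let Q1 : 'cV[F]_p := \col_i q1 i.
Let Q2 : 'cV[F]_p := \col_i q2 i.

Lemma twist_mx_rank2 : twist_mx = b0 + b0 *m Q1 *m v1 + b0 *m Q2 *m v2.
Proof.
have b0Q (f : nat -> F) (i : 'I_p) (u : 'I_1) : (b0 *m \col_j f j) i u =
    a * (if nat_of_ord i is i'.+1 then f i' else 0) - d i * f i.
  by rewrite mxE -mul_b0 //; apply: eq_bigr => j _; rewrite !mxE.
apply/matrixP=> i b; rewrite mxE [RHS]mxE [X in _ = X + _]mxE [X in _ = _ + X + _]mxE.
rewrite [X in _ = _ + X]mxE !big_ord1 !b0Q q1E // q2E //.
rewrite [b0 _ _]mxE [v1 _ _]mxE [v2 _ _]mxE /twist_entry /d.
have -> : (b == (i + (m + r)) %% p :> nat)%N%:R =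
    (i == b.+1 :> nat)%:R + (i == 0%N :> nat)%:R * (b == m + r :> nat)%N%:R :> F.
  case: (nat_of_ord i) (ltn_ord i) => [|k] kp.
    by rewrite add0n modn_small //=; ring.
  rewrite addSnnS modnDr modn_small 1?ltnW // eqSS eq_sym /=; ring.
case: ifP => ir; last by rewrite /=; ring.
by rewrite -prn /c /=; ring.
Qed.

Let det_b0 : \det b0 = (-1) ^+ p * t ^+ (p * r).
Proof.
rewrite det_trig; last first.
  apply/is_trig_mxP=> i j ij; rewrite mxE (gtn_eqF ij) ltn_eqF ?ltnS 1?ltnW //.
  by rewrite !mulr0 subr0.
under eq_bigr do rewrite mxE eqxx mulr1 (ltn_eqF (ltnSn _)) mulr0 add0r -mulN1r.
rewrite big_split prodr_const card_ord /= exprM; congr (_ * _).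
rewrite /d -big_mkcond -(big_ord_widen p (fun=> t ^+ p)) ?prodr_const ?card_ord //.
by rewrite /p ltnW // ltnS leq_addl.
Qed.

Lemma sum_gsum : (1 - t) * \sum_(j < r) gsum t j.+1 = r%:R - t * gsum t r.
Proof.
rewrite mulr_sumr; under eq_bigr do rewrite gsumE exprS.
by rewrite sumrB sumr_const card_ord -mulr_sumr.
Qed.

(* The 2 x 2 determinant, with [tr], [u] and [A] standing for [t ^ r], [t ^ m] and
   [a ^ m]. *)
Let scalar_identity (x tr u A rr : F) : x != 0 -> tr != 0 -> u != 0 ->
  1 - x != 0 -> 1 - tr != 0 -> 1 - u * tr != 0 -> 1 - u * tr * x != 0 ->
  let aa := u * tr in let b := aa * x in
  let R := (1 - tr) / (1 - x) in let P := (1 - b) / (1 - x) in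
  let cc := (1 - x) * ((1 - b) / (1 - tr)) in
  let M := (1 - aa * A) / (1 - aa) in let M' := (1 - A * u) / (1 - b) in
  let S := (rr - x * R) / (1 - x) in
  R * b * ((1 - b) * M * (1 + cc / (aa * x) * S) + aa * A * (cc / aa) * R / tr * R) =
  (1 - b) * P * (rr * M - x * R * M').
Proof.
move=> x0 tr0 u0 x1 tr1 u1 b1 /=; field.
by rewrite x0 tr0 u0 x1 tr1 u1 b1.
Qed.

(** The rows of the rank two part only see the last coordinate of [q1] and [q2]
    and their sums weighted by the powers of [t] over the first [r]
    coordinates. *)
Lemma det_twist_mx :
  gsum t r * t ^+ p * \det twist_mx =
  (-1) ^+ p * t ^+ (p * r) * ((1 - t ^+ p) * gsum t p * twist_numer t p m r).
Proof.
rewrite twist_mx_rank2 det_add_rank2 det_b0.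
have mrp : (m + r < p)%N by [].
have rp : (r <= p)%N by rewrite /p ltnW // ltnS leq_addl.
have v1Q (f : nat -> F) : (v1 *m \col_j f j) 0 0 = f (m + r)%N.
  rewrite mxE; under eq_bigr do rewrite !mxE.
  by rewrite (sum_delta f).
have v2Q (f : nat -> F) : (v2 *m \col_j f j) 0 0 = \sum_(j < r) t ^+ j * f j.
  rewrite mxE; under eq_bigr do rewrite !mxE -mulrA.
  by rewrite (sum_prefix (fun j => t ^+ j * f j)).
rewrite !v1Q !v2Q /q1 /q2 ltnNge leq_addl /= addnK.
have -> : \sum_(j < r) t ^+ j * (if (j < r)%N then -1
      else -1 + (1 - t ^+ p) * gsum a (j - r).+1)
   = - gsum t r.
  by under eq_bigr do rewrite ltn_ord mulrN1; rewrite sumrN.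
have -> : \sum_(j < r) t ^+ j * (if (j < r)%N then c / a * gsum t j.+1 / t ^+ j.+1
       else a ^+ (j - r).+1 * (c / a) * gsum t r / t ^+ r)
   = c / (a * t) * ((r%:R - t * gsum t r) / (1 - t)).
  rewrite -sum_gsum mulrC [(1 - t) * _]mulrC mulfK; last by have := t1 0; rewrite expr1.
  rewrite mulr_sumr; apply: eq_bigr => j _; rewrite ltn_ord exprS; field.
  by rewrite a0 t0 expf_neq0.
have aE : a = t ^+ m * t ^+ r by rewrite -exprD.
have nz k : (0 < k)%N -> 1 - t ^+ k != 0 by case: k.
have a1 : 1 - a != 0 by rewrite nz // addn_gt0 r0 orbT.
have gE (x : F) k : 1 - x != 0 -> gsum x k = (1 - x ^+ k) / (1 - x).
  by move=> x1; rewrite -gsumE mulrC mulKf.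
have t1' : 1 - t != 0 by have := nz 1%N isT; rewrite expr1.
have := @scalar_identity t (t ^+ r) (t ^+ m) (a ^+ m) r%:R t0 (expf_neq0 _ t0)
  (expf_neq0 _ t0) t1' (nz _ r0); rewrite -aE at_ => /(_ a1 (nz p isT)) /=.
rewrite at_.
have <- : c = (1 - t) * ((1 - t ^+ p) / (1 - t ^+ r)).
  by rewrite /c gE ?nz // -exprM -prn.
have <- : gsum t r = (1 - t ^+ r) / (1 - t) by rewrite gE.
have <- : gsum t p = (1 - t ^+ p) / (1 - t) by rewrite gE.
have <- : gsum a m.+1 = (1 - a * a ^+ m) / (1 - a) by rewrite gE // exprS.
have <- : gsum (t ^+ p) m = (1 - a ^+ m * t ^+ m) / (1 - t ^+ p).
  by rewrite gE ?nz // -at_ exprMn.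
rewrite /twist_numer -/a mulrCA => <-.
by rewrite (exprS a m); ring.
Qed.

End TwistDet.

(** * A cofactor of the Alexander matrix of the closure *)

(** The units of Z[t,t^-1] that lie in Z[t], in a form that also makes sense
    inside a field of fractions. *)
Definition signed_power (R : pzRingType) (t x : R) := exists b e, x = (-1) ^+ b * t ^+ e.

Lemma signed_powerM (R : comPzRingType) (t x y : R) :
  signed_power t x -> signed_power t y -> signed_power t (x * y).
Proof.
by move=> [b [e ->]] [b' [e' ->]]; exists (b + b')%N, (e + e')%N; rewrite !exprD; ring.
Qed.

Lemma geom_row_const (R : comNzRingType) (t x : R) p :
  (geom_row t p *m (const_mx x : 'cV_p)) 0 0 = gsum t p * x.
Proof. by rewrite mxE mulr_suml; apply: eq_bigr => j _; rewrite !mxE. Qed.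

Definition torus_twist_word (p r k q : nat) : braid_word :=
  flatten (nseq q (braid_stair p)) ++ flatten (nseq k (braid_inv (braid_stair r))).

Lemma valid_torus_twist_word p r k q : (r <= p)%N -> valid_word p (torus_twist_word p r k q).
Proof.
move=> rp; rewrite /torus_twist_word /valid_word all_cat; apply/andP; split.
  by apply: valid_word_rep; apply: valid_stair.
by apply: valid_word_rep; rewrite valid_word_inv valid_stair.
Qed.

Section Closure.
Variables (F : fieldType) (t : F).
Hypothesis t0 : t != 0.
Hypothesis tk : forall k, t ^+ k.+1 != 1.
Variables (r n m : nat).
Let p := (m + r).+1.
Hypothesis r0 : (0 < r)%N.
Hypothesis prn : p = (r * n)%N.

Let w := torus_twist_word p r (r * n) (m + r).
Let e0 : 'cV[F]_p := delta_mx 0 0.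
Let C := stair_mx t p p ^+ (m + r).
Let G := stair_mx t p r ^+ (r * n).

Let rp : (0 < r <= p)%N. Proof. by rewrite r0 /p ltnW // ltnS leq_addl. Qed.
Let pp : (0 < p <= p)%N. Proof. by rewrite /p leqnn. Qed.
Let vw : valid_word p w. Proof. by apply: valid_torus_twist_word; case/andP: rp. Qed.

(* The product of the two braid factors, cleared of inverses. *)
Let CB : C *m burau_word t p w = G.
Proof.
rewrite /w /torus_twist_word burau_word_cat // !burau_word_rep // burau_word_stair_inv // mulmxA.
have : stair_mx t p p *m burau_word t p (braid_stair p) = 1%:M.
  by apply: mulmx1C; rewrite -burau_word_stair_inv // burau_word_inv // valid_stair.
rewrite -/G /C; move: (burau_word _ _ _) (stair_mx _ _ _) => D S SD.
suff -> : S ^+ (m + r) *m D ^+ (m + r) = 1%:M by rewrite mul1mx.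
elim: (m + r)%N => [|k IH]; first by rewrite !expr0 mulmx1.
rewrite exprSr exprS -[_ * _]/(_ *m _) -[_ * _]/(_ *m _) -mulmxA [S *m _]mulmxA SD.
by rewrite mul1mx.
Qed.

Let wC : geom_row t p *m C = geom_row t p.
Proof.
rewrite /C -burau_word_stair_inv // -burau_word_rep // geom_row_burau_word //.
by apply: valid_word_rep; rewrite valid_word_inv valid_stair.
Qed.

Let wB : geom_row t p *m burau_word t p w = geom_row t p.
Proof. exact: geom_row_burau_word. Qed.

Let twist_mxE : C - G + const_mx (- (1 - t)) *m geom_row t p = twist_mx t r n m.
Proof.
rewrite /C /G (stair_mxX t pp (leqnSn _)) (full_twistX t n rp).
apply/matrixP=> i b; rewrite !mxE big_ord1 !mxE /stair_pow_entry ltn_ord.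
have -> : t ^+ b = (b < m + r)%N%:R * t ^+ b + t ^+ (m + r) * (b == m + r :> nat)%N%:R.
  case: (ltngtP b (m + r)%N) => bm; last by rewrite bm /=; ring.
    by rewrite /=; ring.
  by rewrite ltnNge -ltnS (ltn_ord b) in bm.
have -> : (b < m + r)%N%:R * ((b < m + r)%N%:R * t ^+ b +
    t ^+ (m + r) * (b == m + r :> nat)%N%:R) = (b < m + r)%N%:R * t ^+ b.
  case: ltnP => bm; last by rewrite !mul0r.
  by rewrite (ltn_eqF bm) /=; ring.
by ring.
Qed.

(** Both determinants are rank one perturbations of [C - G] along [w]: one by
    the constant column, which cancels the dense part of [C], the other by
    [C e_0], which comes from the closing rows. *)
Lemma det_twist_reduction :
  \det (twist_mx t r n m) = - (1 - t ^+ p) * \det C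
    * \det (1%:M - (1%:M - e0 *m geom_row t p) *m burau_word t p w).
Proof.
have we0 : (geom_row t p *m e0) 0 0 = 1.
  by rewrite -colE !mxE expr0.
have wA : geom_row t p *m (C - G) = 0.
  by rewrite mulmxBr wC -CB mulmxA wC wB subrr.
rewrite -twist_mxE (det_add_rank1 (u := C *m e0) _ wA); last by rewrite mulmxA wC.
rewrite geom_row_const mulrN [_ * (1 - t)]mulrC gsumE -mulrA -det_mulmx; congr (_ * \det _).
by rewrite mulmxBr mulmx1 mulmxBl mul1mx mulmxBr CB -!mulmxA wB opprB addrA addrAC.
Qed.

(** The closing row [i] perturbed by [w] gives [gsum t p] times the cofactor on
    one hand, and [det_twist_mx] on the other; the common factors
    [1 - t ^ p] and [gsum t p] cancel. *)
Lemma cofactor_torus_twist (A : 'M[F]_((size w).+1 * p)) (i j : 'I_((size w).+1 * p)) :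
  A = level_mx t p _ w - last_level F p _ (size w) *m first_level F p _ ->
  i = (size w * p)%N :> nat ->
  exists x y, [/\ signed_power t x, signed_power t y &
    x * (gsum t r * cofactor A i j) = y * twist_numer t p m r].
Proof.
set N := (_ * p)%N => AE iE.
have A1 : A *m const_mx 1 = 0 :> 'cV_N.
  rewrite AE mulmxBl level_mx_const // -mulmxA first_level_const ?subrr //.
  by rewrite /N mulSn leq_addr.
have e0E : last_level F p N (size w) *m e0 = delta_mx i 0.
  by rewrite -colE; apply/matrixP=> k b; rewrite !mxE !ord1 andbT addn0 -iE.
have := det_add_row (geom_row t p *m first_level F p N) i j A1.
rewrite -[geom_row _ _ *m _ *m _]mulmxA first_level_const; last by rewrite /N mulSn leq_addr.
rewrite geom_row_const mulr1.
have -> : A + delta_mx i 0 *m (geom_row t p *m first_level F p N) =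
   level_mx t p N w - last_level F p N (size w) *m (1%:M - e0 *m geom_row t p)
     *m first_level F p N.
  by rewrite AE mulmxBr mulmx1 mulmxBl -e0E opprB addrA addrAC !mulmxA.
have [b [e ->]] := det_level_mx t0 (1%:M - e0 *m geom_row t p) vw (erefl N).
move=> kE; have := det_twist_mx t0 tk r0 prn.
rewrite det_twist_reduction -/p.
have nz k : 1 - t ^+ k.+1 != 0 by rewrite subr_eq0 eq_sym.
have gp0 : gsum t p != 0.
  by apply: contra_neq (nz (m + r)%N) => g0; rewrite -/p -gsumE g0 mulr0.
set D := \det (1%:M - _) in kE *; move=> eq.
have sC : signed_power t (\det C).
  rewrite /C; elim: (m + r)%N => [|k IH]; 
    first by rewrite expr0 det1; exists 0, 0; rewrite mulr1.
  rewrite exprS det_mulmx; apply: signed_powerM IH.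
  by rewrite (det_stair_mx t pp); exists p.-1, p.-1; rewrite [LHS]exprNn.
exists (t ^+ p * \det C), (- ((-1) ^+ p * t ^+ (p * r)) * ((-1) ^+ b * t ^+ e)); split.
- by apply: signed_powerM => //; exists 0, p; rewrite mul1r.
- apply: signed_powerM; last by exists b, e.
  by exists p.+1, (p * r)%N; rewrite exprS; ring.
apply: (mulfI gp0); apply: (mulfI (nz (m + r)%N)); rewrite -/p.
transitivity (gsum t r * t ^+ p * ((1 - t ^+ p) * \det C * (gsum t p * cofactor A i j))).
  by ring.
rewrite -kE.
transitivity (- ((-1) ^+ b * t ^+ e) * (gsum t r * t ^+ p * (- (1 - t ^+ p) * \det C * D))).
  by ring.
by rewrite eq; ring.
Qed.

End Closure.

(** * Degree and leading coefficient up to units of the Laurent ring *)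

Section LaurentDegree.
Implicit Types P Q R : {poly int}.

Lemma low_exponentP P : P != 0 ->
  [/\ P`_(low_exponent P) != 0, (forall i, (i < low_exponent P)%N -> P`_i = 0) &
   (low_exponent P < size P)%N].
Proof.
move=> P0; have hP : has (fun c => c != 0) P.
  apply/hasP; exists (lead_coef P); last by rewrite lead_coef_eq0.
  by rewrite lead_coefE mem_nth // prednK // lt0n size_poly_eq0.
split; last by rewrite -has_find.
  exact: (nth_find 0 hP).
by move=> i /(before_find 0) /negbFE/eqP.
Qed.

Lemma low_exponent_eq P k : P`_k != 0 -> (forall i, (i < k)%N -> P`_i = 0) ->
  low_exponent P = k.
Proof.
move=> Pk lowP; have P0 : P != 0 by apply: contraNneq Pk => ->; rewrite coef0.
have [Pl lowl _] := low_exponentP P0.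
case: (ltngtP (low_exponent P) k) => // h; first by rewrite lowP ?eqxx in Pl.
by rewrite lowl ?eqxx in Pk.
Qed.

(** The product of the lowest terms is the lowest term of the product. *)
Lemma low_exponentM P Q : P != 0 -> Q != 0 ->
  low_exponent (P * Q) = (low_exponent P + low_exponent Q)%N.
Proof.
move=> P0 Q0; have [Pl lP _] := low_exponentP P0; have [Ql lQ _] := low_exponentP Q0.
apply: low_exponent_eq => [|k kl].
  rewrite coefM (bigD1 (inord (low_exponent P))) //= inordK ?ltnS ?leq_addr // addKn.
  rewrite big1 ?addr0 ?mulf_neq0 // => i.
  rewrite -val_eqE /= inordK ?ltnS ?leq_addr // => il.
  case: (ltngtP i (low_exponent P)) il => // h _; first by rewrite lP // mul0r.
  by rewrite [Q`_ _]lQ ?mulr0 //; have := ltn_ord i; lia.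
rewrite coefM big1 // => i _; case: (ltnP i (low_exponent P)) => h.
  by rewrite lP // mul0r.
by rewrite [Q`_ _]lQ ?mulr0 //; have := ltn_ord i; lia.
Qed.

Lemma laurent_degreeM P Q : P != 0 -> Q != 0 ->
  laurent_degree (P * Q) = laurent_degree P + laurent_degree Q.
Proof.
move=> P0 Q0; rewrite /laurent_degree low_exponentM // size_mul //.
rewrite -!size_poly_gt0 in P0 Q0; move: P0 Q0.
case: (size P) => // k _; case: (size Q) => // l _; rewrite addnS /=; lia.
Qed.

Lemma laurent_leadM P Q : laurent_lead (P * Q) = laurent_lead P * laurent_lead Q.
Proof. by rewrite /laurent_lead lead_coefM normrM. Qed.

Lemma laurent_degree_ge0 P : P != 0 -> 0 <= laurent_degree P.
Proof.
move=> P0; have [_ _] := low_exponentP P0; rewrite /laurent_degree.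
case: (size P) => //= k; rewrite ltnS; lia.
Qed.

Lemma laurent_lead_ge1 P : P != 0 -> 1 <= laurent_lead P.
Proof.
rewrite -lead_coef_eq0 /laurent_lead; move: (lead_coef P) => c c0; lia.
Qed.

Lemma laurent_signed_power b e :
  [/\ (-1) ^+ b * 'X^e != 0 :> {poly int}, laurent_lead ((-1) ^+ b * 'X^e) = 1 &
   laurent_degree ((-1) ^+ b * 'X^e) = 0].
Proof.
have -> : (-1) ^+ b * 'X^e = (-1) ^+ b *: 'X^e :> {poly int}.
  by rewrite -mul_polyC rmorphXn rmorphN1.
have s0 : (-1) ^+ b != 0 :> int by rewrite signr_eq0.
split; first by rewrite scale_poly_eq0 negb_or s0 monic_neq0 // monicXn.
  by rewrite /laurent_lead lead_coefZ lead_coefXn mulr1 normrX normrN1 expr1n.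
rewrite /laurent_degree size_scale // size_polyXn (@low_exponent_eq _ e) ?subrr //.
  by rewrite coefZ coefXn eqxx mulr1.
by move=> i ie; rewrite coefZ coefXn (ltn_eqF ie) mulr0.
Qed.

(** Leading coefficients multiply, degrees add, and powers of the variable do
    not contribute.  Two polynomials that divide each other thus share both
    invariants, without any description of the units. *)
Lemma laurent_dvd_le P Q : laurent_dvd P Q -> Q != 0 ->
  [/\ P != 0, laurent_lead P <= laurent_lead Q & laurent_degree P <= laurent_degree Q].
Proof.
move=> [k [R E]] Q0; have [X0 X1 Xd] := laurent_signed_power 0 k.
rewrite expr0 mul1r in X0 X1 Xd.
have RP0 : R * P != 0 by rewrite -E mulf_neq0.
have [R0 P0] : R != 0 /\ P != 0 by apply/andP; rewrite -negb_or -mulf_eq0.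
have := congr1 laurent_lead E; have := congr1 laurent_degree E.
rewrite !laurent_leadM !laurent_degreeM // X1 Xd mul1r add0r => -> ->; split=> //.
  by rewrite ler_peMl ?laurent_lead_ge1 // normr_ge0.
by rewrite lerDr laurent_degree_ge0.
Qed.
End LaurentDegree.

Lemma gsum_map (R S : nzRingType) (f : {rmorphism R -> S}) x k : f (gsum x k) = gsum (f x) k.
Proof. by rewrite rmorph_sum; apply: eq_bigr => i _; rewrite rmorphXn. Qed.

Lemma twist_numer_map (R S : comNzRingType) (f : {rmorphism R -> S}) x p m r :
  f (twist_numer x p m r) = twist_numer (f x) p m r.
Proof. by rewrite /twist_numer rmorphB !rmorphM rmorph_nat !gsum_map !rmorphXn. Qed.

(** The term of highest exponent and the constant term of the sum do not
    interact with the others. *)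
Lemma gsum_Xn k n : (0 < k)%N ->
  [/\ size (gsum ('X^k : {poly int}) n.+1) = (k * n).+1,
      lead_coef (gsum ('X^k : {poly int}) n.+1) = 1 &
      (gsum ('X^k : {poly int}) n.+1)`_0 = 1].
Proof.
move=> k0; elim: n => [|n [IHs IHl IH0]].
  by rewrite muln0 /gsum big_ord1 expr0 size_poly1 lead_coef1 coef1.
have lt : (size (gsum ('X^k : {poly int}) n.+1) < size ('X^k ^+ n.+1 : {poly int}))%N.
  by rewrite IHs -exprM size_polyXn ltnS mulnS -[X in (X < _)%N]add0n ltn_add2r.
rewrite gsumS addrC size_polyDl // lead_coefDl //; split.
- by rewrite -exprM size_polyXn.
- by rewrite -exprM lead_coefXn.
- by rewrite coefD IH0 -exprM coefXn eq_sym muln_eq0 (gtn_eqF k0) add0r.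
Qed.

(** The first term has degree [(p-1) m]; since [p = m + r + 1], the second has
    degree exactly one less, and no constant term. *)
Lemma twist_numer_degree m r : (0 < r)%N ->
  let p := (m + r).+1 in let N := twist_numer ('X : {poly int}) p m r in
  [/\ N != 0, laurent_lead N = r%:Z & laurent_degree N = (p.-1 * m)%N%:Z].
Proof.
move=> r0 p N.
have [s1 l1 c1] := @gsum_Xn p.-1 m ltac:(rewrite /p /=; lia).
have rE : r%:R * gsum ('X^(p.-1)) m.+1 = r%:Z *: gsum 'X^(p.-1) m.+1 :> {poly int}.
  by rewrite -mul_polyC -[X in X%:P]natz rmorph_nat.
have rz : r%:Z != 0 by rewrite eqz_nat -lt0n.
have sz1 : size (r%:R * gsum ('X^(p.-1) : {poly int}) m.+1) = (p.-1 * m).+1.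
  by rewrite rE size_scale.
have lt : (size (- ('X * gsum ('X : {poly int}) r * gsum 'X^p m)) < (p.-1 * m).+1)%N.
  rewrite size_polyN; case: m => [|k] in p N s1 l1 c1 rE sz1 *.
    by rewrite /gsum [X in _ * X]big_ord0 mulr0 size_poly0.
  have [s2 l2 _] := @gsum_Xn 1 r.-1 isT; have [s3 l3 _] := @gsum_Xn p k isT.
  rewrite expr1 prednK // in s2 l2.
  have n2 : gsum ('X : {poly int}) r != 0 by rewrite -lead_coef_eq0 l2.
  have n3 : gsum ('X^p : {poly int}) k.+1 != 0 by rewrite -lead_coef_eq0 l3.
  rewrite size_mul ?mulf_neq0 ?polyX_eq0 // size_mul ?polyX_eq0 //.
  rewrite size_polyX s2 s3 /p /=; nia.
have NE : N = r%:R * gsum ('X^(p.-1)) m.+1 + - ('X * gsum 'X r * gsum 'X^p m) by [].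
have leadN : lead_coef N = r%:Z.
  by rewrite NE lead_coefDl ?sz1 // rE lead_coefZ l1 mulr1.
have N0 : N`_0 = r%:Z.
  by rewrite NE coefD rE coefZ c1 mulr1 coefN -mulrA coefXM /= subr0.
split; first by rewrite -lead_coef_eq0 leadN.
  by rewrite /laurent_lead leadN.
by rewrite /laurent_degree (@low_exponent_eq _ 0) ?N0 // NE size_polyDl sz1 // subr0.
Qed.

Lemma laurent_dvd_mul_signed (D P Q x y : {poly int}) :
  signed_power 'X x -> signed_power 'X y -> x * P = y * Q ->
  laurent_dvd D Q -> laurent_dvd D P.
Proof.
move=> [b [e ->]] [b' [e' ->]] E [k [R kQ]].
exists (k + e)%N, ((-1) ^+ b * ((-1) ^+ b' * 'X^e') * R).
have s1 : (-1) ^+ b * (-1) ^+ b = 1 :> {poly int}.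
  by rewrite -exprMn mulrNN mulr1 expr1n.
move: s1 E; move: ((-1) ^+ b) ((-1) ^+ b' * 'X^e') => s y0 s1 E.
have -> : 'X^(k + e) * P = s * 'X^k * (s * 'X^e * P).
  by rewrite [RHS]mulrA [in RHS]mulrACA s1 mul1r exprD.
by rewrite E -!mulrA -kQ; congr (_ * _); rewrite mulrCA.
Qed.

(** * The Alexander polynomial as a single cofactor *)

Section FirstMinors.
Variables (n : nat) (w : braid_word).
Hypothesis n0 : (0 < n)%N.
Hypothesis wn : valid_word n w.
Let g := closure_ngens n w.
Let A := alexander_matrix g (closure_relations n w).
Let M : 'M[{poly int}]_g := level_mx 'X n g w -
  last_level _ n g (size w) *m first_level _ n g.

Let eg : size (closure_relations n w) = g := size_closure_relations n w.
Let g0 : (0 < g)%N. Proof. by rewrite /g /closure_ngens muln_gt0. Qed.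

(** All first minors vanish or are associated to one cofactor, so that the
    first elementary ideal becomes principal over Z[t,t^-1]. *)
Lemma divides_first_minorsP (i0 j0 : 'I_g) (D : {poly int}) :
  divides_first_minors A D <-> laurent_dvd D (cofactor M i0 j0).
Proof.
have subE (f : 'I_g.-1 -> 'I_(size (closure_relations n w))) (h : 'I_g.-1 -> 'I_g) :
    mxsub f h A = mxsub (cast_ord eg \o f) h M.
  by apply/matrixP=> i j; rewrite [LHS]mxE [RHS]mxE; apply: alexander_level_mx.
have M1 : M *m const_mx 1 = 0 :> 'cV_g.
  rewrite mulmxBl level_mx_const // -mulmxA first_level_const ?subrr //.
  by rewrite /g /closure_ngens mulSn leq_addr.
have [y [yA yJ yE]] := level_mx_left_kernel ('X : {poly int}) wn (erefl g).
have yM : y *m M = 0 by rewrite mulmxBr yA mulmxA yJ subrr.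
have y0 : y 0 i0 != 0.
  by have [b [e ->]] := yE i0; case: (laurent_signed_power b e).
split=> [dvdD | dvdD f h].
- have := dvdD (cast_ord (esym eg) \o lift i0) (lift j0); rewrite subE.
  apply: (laurent_dvd_mul_signed (x := 1) (y := (-1) ^+ (i0 + j0))).
  + by exists 0, 0; rewrite mulr1.
  + by exists (i0 + j0)%N, 0; rewrite mulr1.
  rewrite mul1r /cofactor; congr (_ * \det _); apply/matrixP=> i j.
  rewrite [LHS]mxE [LHS]mxE [RHS]mxE.
  by congr (M _ _); apply: val_inj.
- rewrite subE; have : \det (mxsub (cast_ord eg \o f) h M) = 0 \/
    exists i j (b : nat), \det (mxsub (cast_ord eg \o f) h M) = (-1) ^+ b * cofactor M i j.
    by move: (cast_ord eg \o f) h; case: (g) g0 M => // k _ M' f' h'; apply: det_mxsub_cofactor.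
  case=> [->|[i [j [b ->]]]]; first by exists 0, 0; rewrite mulr0 mul0r.
  have [b1 [e1 y1]] := yE i0; have [b2 [e2 y2]] := yE i.
  apply: (laurent_dvd_mul_signed (x := y 0 i0) (y := (-1) ^+ b * y 0 i)) dvdD.
  + by exists b1, e1.
  + by exists (b + b2)%N, e2; rewrite y2 exprD mulrA.
  rewrite mulrCA (cofactor_left_kernel i j yM y0) mulrA.
  by rewrite (cofactor_right_kernel i0 j j0 M1).
Qed.

Lemma exists_alexander_polynomial : exists P, is_alexander_polynomial n w P.
Proof.
have i0 : 'I_g := Ordinal g0.
exists (cofactor M i0 i0); split.
  by apply/(divides_first_minorsP i0 i0); exists 0, 1; rewrite expr0.
by move=> D /(divides_first_minorsP i0 i0).
Qed.

Lemma alexander_polynomial_cofactor (i0 j0 : 'I_g) P :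
  cofactor M i0 j0 != 0 -> is_alexander_polynomial n w P ->
  laurent_lead P = laurent_lead (cofactor M i0 j0) /\
  laurent_degree P = laurent_degree (cofactor M i0 j0).
Proof.
move=> k0 [/(divides_first_minorsP i0 j0) Pk Pmax].
have kP : laurent_dvd (cofactor M i0 j0) P.
  by apply: Pmax; apply/(divides_first_minorsP i0 j0); exists 0, 1; rewrite expr0.
have [P0 le1 le2] := laurent_dvd_le Pk k0; have [_ ge1 ge2] := laurent_dvd_le kP P0.
by split; apply/eqP; rewrite eq_le ?le1 ?ge1 ?le2 ?ge2.
Qed.
End FirstMinors.

(** * Conclusion *)

Lemma level_entry_map (R S : comNzRingType) (f : {rmorphism R -> S}) t p w i j :
  f (level_entry t p w i j) = level_entry (f t) p w i j.
Proof.
have fB l a b : f (burau_entry t l a b) = burau_entry (f t) l a b.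
  by rewrite /burau_entry rmorphD !rmorphM !rmorphB rmorphM !rmorph_nat.
elim: w i j => [|l w IH] i j /=; first by rewrite rmorph_nat.
do !case: ifP => _; rewrite ?rmorph0 ?IH // /pre_entry /post_entry; case: ifP => _;
  by rewrite ?rmorphN ?fB ?rmorph_nat.
Qed.

(** The cofactor is computed in the field of fractions and the identity brought
    back to Z[t], where degrees are compared. *)
Lemma torus_twist_alexander r n m P : (0 < r)%N -> (m + r).+1 = (r * n)%N ->
  let p := (m + r).+1 in
  is_alexander_polynomial p (torus_twist_word p r (r * n) (m + r)) P ->
  laurent_lead P = r%:Z /\ laurent_degree P = (p.-1 * m)%N%:Z - r.-1%:Z.
Proof.
move=> r0 prn p; set w := torus_twist_word _ _ _ _ => alexP.
have wp : valid_word p w by apply: valid_torus_twist_word; rewrite /p; lia.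
pose phi : {rmorphism {poly int} -> {fraction {poly int}}} := @tofrac _.
pose t := phi 'X.
have t0 : t != 0 by rewrite tofrac_eq0 polyX_eq0.
have tk k : t ^+ k.+1 != 1.
  rewrite -tofracXn -tofrac1 tofrac_eq; apply/eqP=> /(congr1 (fun q : {poly int} => q`_0)).
  by rewrite coefXn coef1.
pose g := closure_ngens p w.
have i0P : (size w * p < g)%N.
  by rewrite /g /closure_ngens mulSn -[X in (X < _)%N]add0n ltn_add2r.
pose i0 : 'I_g := Ordinal i0P.
pose M : 'M[{poly int}]_g := level_mx 'X p g w -
  last_level _ p g (size w) *m first_level _ p g.
have ME : map_mx phi M = level_mx t p g w - last_level _ p g (size w) *m first_level _ p g.
  have -> : level_mx t p g w = map_mx phi (level_mx 'X p g w).
    by apply/matrixP=> i j; rewrite !mxE level_entry_map.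
  rewrite map_mxB map_mxM; congr (_ - _ *m _);
    by apply/matrixP=> i j; rewrite !mxE rmorph_nat.
have [x [y [[b [e xE]] [b' [e' yE]] E]]] := cofactor_torus_twist t0 tk r0 prn i0 ME
  (erefl : nat_of_ord i0 = (size w * p)%N).
have {E} E : ((-1) ^+ b * 'X^e) * (gsum 'X r * cofactor M i0 i0) =
    ((-1) ^+ b' * 'X^e') * twist_numer 'X p m r.
  have phi_inj : injective phi by move=> u v /eqP; rewrite tofrac_eq => /eqP.
  apply: phi_inj.
  move: E; rewrite xE yE cofactor_map_mx /t -gsum_map -twist_numer_map.
  by rewrite !rmorphM !rmorphXn !rmorphN1.
have [N0 Nl Nd] := twist_numer_degree m r0.
move: (laurent_signed_power b e) (laurent_signed_power b' e') E.
move: ((-1) ^+ b * 'X^e) ((-1) ^+ b' * 'X^e') => u v [x0 x1 xd] [y0 y1 yd] E.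
have [sz ld c0] := @gsum_Xn 1 r.-1 isT; rewrite expr1 prednK // in sz ld c0.
have gz : gsum ('X : {poly int}) r != 0 by rewrite -lead_coef_eq0 ld.
have gl : laurent_lead (gsum 'X r) = 1 by rewrite /laurent_lead ld.
have gd : laurent_degree (gsum 'X r) = r.-1%:Z.
  rewrite /laurent_degree sz (@low_exponent_eq _ 0) ?c0 // subr0; congr (Posz _); lia.
have k0 : cofactor M i0 i0 != 0.
  apply: contra_eq_neq E => ->; rewrite !mulr0 eq_sym; exact: mulf_neq0.
have [] := alexander_polynomial_cofactor (ltn0Sn _) wp k0 alexP.
rewrite -/p -/g -/M; move: N0 Nl Nd k0 E.
move: (cofactor M i0 i0) (twist_numer _ _ _ _) => kappa N N0 Nl Nd k0 E.
have := congr1 laurent_lead E; have := congr1 laurent_degree E.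
rewrite !laurent_leadM !laurent_degreeM ?mulf_neq0 // x1 y1 xd yd gl gd Nl Nd !mul1r !add0r.
by move=> <- <- -> ->; split=> //; rewrite [X in X - _]addrC addrK.
Qed.

Theorem theorem1p1 (r s : int) (hr : 0 < r) (hs : s < -1) :
  let p : int := r * `|s| in
  let K : braid_word := twisted_torus_braid p (p - 1) r s in
  (exists P : {poly int}, is_alexander_polynomial `|p|%N K P) /\
  (forall P : {poly int}, is_alexander_polynomial `|p|%N K P ->
     laurent_lead P = r /\
     laurent_degree P = r * `|s| * (r * `|s| - r - 2) + 2).
Proof.
case: r hr => // r hr; case: s hs => // n hs; rewrite ltz_nat in hr.
have n0 : (0 < n)%N by lia.
pose m := (r * n).-1.
have rn0 : (0 < r * n)%N by rewrite muln_gt0 hr.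
have prn : (m + r).+1 = (r * n.+1)%N by rewrite /m mulnS; lia.
have pE : r%:Z * `|Negz n| = (m + r).+1%:Z by rewrite prn PoszM.
rewrite pE => p K.
have KE : K = torus_twist_word (m + r).+1 r (r * n.+1) (m + r).
  rewrite /K /twisted_torus_braid /torus_twist_word; congr (_ ++ _).
    by have -> : p - 1 = (m + r)%N%:Z by rewrite /p; lia.
  have -> : r%:Z * Negz n = Negz (m + r) by rewrite NegzE mulrN -PoszM -prn NegzE.
  by rewrite -prn.
rewrite KE -[`|p|%N]/((m + r).+1); split.
  by apply: exists_alexander_polynomial => //; apply: valid_torus_twist_word; lia.
move=> P /(torus_twist_alexander hr prn) [-> ->]; split=> //.
rewrite /m; nia.
Qed.
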